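(* Let $K$ be a $D_5$-extension with a unique real embedding. Then the unit shape of $K$, viewed as a point of $\mathrm{GL}_2(\mathbf{Z})\backslash\mathfrak{H}$, lies on (the image in $\mathrm{GL}_2(\mathbf{Z})\backslash\mathfrak{H}$ of) the arc of the circle $$\left(x+\tfrac{1}{2}\right)^2+\left(y-\tfrac{1}{2\sqrt{3}}\right)^2=\left(\tfrac{2}{\sqrt{3}}\right)^2$$ in the upper half plane from $\frac{1+i\sqrt{3}}{2}$ to $-\frac{1}{2}+i\frac{5}{2\sqrt{3}}$.
   Context: A $D_5$-extension is a number field $K$ of degree $5$ over $\mathbf{Q}$ whose Galois closure over $\mathbf{Q}$ has Galois group isomorphic to the dihedral group $D_5$ of order $10$. Let $K$ be a number field with real embeddings $\sigma_1,\dots,\sigma_{r_1}$ and pairs of complex conjugate embeddings $\tau_1,\overline{\tau_1},\dots,\tau_s,\overline{\tau_s}$. Let $E_K=\mathcal{O}_K^\times/\text{torsion}$. The logarithmic embedding is $$\mathrm{Log}\colon E_K\to\mathbf{R}^{r_1+s},\quad u\mapsto(\log|\sigma_1(u)|,\dots,\log|\sigma_{r_1}(u)|,2\log|\tau_1(u)|,\dots,2\log|\tau_s(u)|).$$ It presents $E_K$ as a lattice of rank $r_1+s-1$ (the unit lattice), with $\mathbf{R}^{r_1+s}$ carrying the standard inner product. For a $D_5$-extension with a unique real embedding, $r_1=1$, $s=2$ and the rank is $2$. The shape of a lattice is its equivalence class under scaling, rotation and reflection; the unit shape of $K$ is the shape of its unit lattice. The space of shapes of rank $2$ lattices is identified with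 $\mathrm{GL}_2(\mathbf{Z})\backslash\mathfrak{H}$, where $\mathfrak{H}=\{x+iy: x,y\in\mathbf{R},\ y>0\}$, as follows: a rank $2$ lattice with ordered $\mathbf{Z}$-basis $v_0,v_1$ and Gram matrix $G=(\langle v_i,v_j\rangle)_{0\le i,j\le 1}$ is sent to the class of $x+iy$ with $x=G_{01}/G_{00}$ and $y=\sqrt{G_{11}/G_{00}-x^2}$. Here a matrix $\begin{pmatrix}a&b\\c&d\end{pmatrix}\in\mathrm{GL}_2(\mathbf{Z})$ acts on $\mathfrak{H}$ by $z\mapsto\frac{az+b}{cz+d}$ if its determinant is $1$ and by $z\mapsto\frac{a\bar z+b}{c\bar z+d}$ if its determinant is $-1$. *)

(* Defs.v *)
From mathcomp Require Import all_boot all_order all_fingroup all_algebra.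
From mathcomp Require Import all_solvable all_field.

Set Implicit Arguments.
Unset Strict Implicit.
Unset Printing Implicit Defensive.

Import Order.TTheory GRing.Theory Num.Theory.
Local Open Scope ring_scope.

(* A number field is a [fieldExtType rat]; [iota] exhibits L as the smallest
   Galois extension of Q containing a copy of K. *)
Definition is_galois_closure (K : fieldExtType rat) (L : splittingFieldType rat)
    (iota : 'AHom(K, L)) : Prop :=
  galois 1 {:L} /\
  forall E : {subfield L}, (limg iota <= E)%VS -> galois 1 E -> E = {:L}%AS.

(* In MathComp the index of 'D_m is the order of the group: 'D_10 is the
   dihedral group of order 10. *)
Definition is_D5_extension (K : fieldExtType rat) : Prop :=
  \dim {:K} = 5%N /\
  exists (L : splittingFieldType rat) (iota : 'AHom(K, L)),
    is_galois_closure iota /\ ('Gal({:L} / 1) \isog 'D_10)%g.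

(* Loaded here because the notations of the derivative and of the dihedral
   groups clash. *)
From mathcomp Require Import classical_sets reals exp complex.

Local Open Scope classical_set_scope.
Local Open Scope complex_scope.

Definition unique_real_embedding (R : realType) (K : fieldExtType rat) : Prop :=
  exists sigma : {rmorphism K -> R},
    forall sigma' : {rmorphism K -> R}, sigma' =1 sigma.

Definition is_real_valued (R : realType) (K : fieldExtType rat)
    (rho : {rmorphism K -> R[i]}) : Prop :=
  forall x : K, complex.Im (rho x) = 0.

(* [sigma] lists each real embedding once, and [tau] lists exactly one member
   of each pair of complex conjugate non-real embeddings. *)
Definition enumerates_embeddings (R : realType) (K : fieldExtType rat)
    (r1 s : nat) (sigma : 'I_r1 -> {rmorphism K -> R})
    (tau : 'I_s -> {rmorphism K -> R[i]}) : Prop :=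
  [/\ forall rho : {rmorphism K -> R}, exists! i, sigma i =1 rho,
      forall j, ~ is_real_valued (tau j)
    & forall rho : {rmorphism K -> R[i]}, ~ is_real_valued rho ->
        exists! j, tau j =1 rho \/ (fun x => conjc (tau j x)) =1 rho].

Definition is_algebraic_integer (K : fieldExtType rat) (x : K) : Prop :=
  integralOver (intr : int -> K) x.

Definition ring_of_integers_units (K : fieldExtType rat) : set K :=
  [set u | [/\ u != 0, is_algebraic_integer u & is_algebraic_integer u^-1]].

Definition Log (R : realType) (K : fieldExtType rat)
    (r1 s : nat) (sigma : 'I_r1 -> {rmorphism K -> R})
    (tau : 'I_s -> {rmorphism K -> R[i]}) (u : K) : 'rV[R]_(r1 + s) :=
  row_mx (\row_(i < r1) ln `|sigma i u|)
         (\row_(j < s) (2 * ln (ComplexField.Normc.normc (tau j u)))).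

(* Log vanishes on torsion, so the image of the whole unit group is the image
   of its quotient E_K by torsion. *)
Definition unit_lattice (R : realType) (K : fieldExtType rat)
    (r1 s : nat) (sigma : 'I_r1 -> {rmorphism K -> R})
    (tau : 'I_s -> {rmorphism K -> R[i]}) : set 'rV[R]_(r1 + s) :=
  Log sigma tau @` @ring_of_integers_units K.

Definition is_lattice_basis (R : realType) (m n : nat) (Lambda : set 'rV[R]_n)
    (B : 'M[R]_(m, n)) : Prop :=
  row_free B /\
  Lambda = [set map_mx (intr : int -> R) z *m B | z in [set: 'rV[int]_m]].

Definition gram (R : realType) (m n : nat) (B : 'M[R]_(m, n)) : 'M[R]_m :=
  B *m B^T.

Definition shape_point (R : realType) (n : nat) (B : 'M[R]_(2, n)) : R[i] :=
  let G := gram B in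
  let x := G 0 1 / G 0 0 in
  x +i* Num.sqrt (G 1 1 / G 0 0 - x ^+ 2).

Definition upper_half_plane (R : realType) : set R[i] :=
  [set z | 0 < complex.Im z].

Definition GL2Z_act (R : realType) (g : 'M[int]_2) (z : R[i]) : R[i] :=
  let w := if \det g == 1 then z else conjc z in
  ((g 0 0)%:~R * w + (g 0 1)%:~R) / ((g 1 0)%:~R * w + (g 1 1)%:~R).

(* Points of the quotient of the upper half plane by GL_2(Z) are orbits. *)
Definition GL2Z_orbit (R : realType) (z : R[i]) : set R[i] :=
  [set GL2Z_act g z | g in [set g : 'M[int]_2 | g \in unitmx]].

Definition shape_class (R : realType) (n : nat) (B : 'M[R]_(2, n)) : set R[i] :=
  GL2Z_orbit (shape_point B).

Definition arc_start (R : realType) : R[i] := (1 / 2) +i* (Num.sqrt 3 / 2).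

Definition arc_end (R : realType) : R[i] := (- (1 / 2)) +i* (5 / (2 * Num.sqrt 3)).

Definition on_circle (R : realType) (z : R[i]) : Prop :=
  (complex.Re z + 1 / 2) ^+ 2 + (complex.Im z - 1 / (2 * Num.sqrt 3)) ^+ 2
    = (2 / Num.sqrt 3) ^+ 2.

(* Over the strip between the abscissae of the endpoints, the part of the
   circle in the upper half plane is the graph of a function of Re z, so these
   conditions cut out exactly the closed arc joining the endpoints. *)
Definition circle_arc (R : realType) : set R[i] :=
  [set z | [/\ @upper_half_plane R z, on_circle z
             & complex.Re (arc_end R) <= complex.Re z <= complex.Re (arc_start R)]].

(* Main.v *)
From HB Require Import structures.
Require Import Defs.
From mathcomp Require Import all_boot all_order all_fingroup all_algebra.
From mathcomp Require Import all_solvable all_field.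
From mathcomp Require Import classical_sets reals exp complex.
From mathcomp Require Import ring lra zify.

(** Let [L] be the Galois closure of [K], with Galois group D_5.  Embed [L] in
    the complex numbers by [rho] so that [K] lands in the reals.  Complex
    conjugation then induces the reflection [h] of D_5 that fixes [K]; let [r]
    be a rotation of order 5.  The five embeddings of [K] are [rho r^k], and
    [rho r^k], [rho r^-k] are conjugate, so a unit [u] has three logarithms
    a0, a1, a2, the values of [ln |rho (r^k u)|] for k = 0, 1, 2, subject to
    a0 + 2 a1 + 2 a2 = 0 because the norm of [u] is 1 or -1.

    The idea is that r + r^-1 acts on the units of [K]: r(u) r^-1(u) is fixed
    by [h], hence belongs to [K] (lemma [D5_units]).  This makes the unit
    lattice a module over Z[t] / (t^2 + t - 1).  On the plane
    a0 + 2 a1 + 2 a2 = 0 the operator is diagonalised by coordinates p, q with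
    a0 = p + q, 2 a1 = alpha p + beta q, 2 a2 = beta p + alpha q, where alpha
    and beta are the roots of t^2 + t - 1, and the squared norm a0^2 + (2 a1)^2
    + (2 a2)^2 becomes 4 p^2 + 4 q^2 - 2 p q ([gram_eigen_mx]).

    Since an integral binary form of discriminant 5 represents 1 or -1
    ([form5_represents_unit]), the lattice has a basis (v, alpha v), where v is
    determined up to the units of Z[alpha].  The shape of that basis depends
    only on the ratio p / q of the coordinates of v: as the ratio runs over the
    positive reals, the shape runs over an arc of the circle of the theorem.
    Multiplying v by alpha changes the sign of p / q, and by alpha^2 it
    multiplies p / q by alpha^4; so p / q can be brought into the interval
    [alpha^2, alpha^-2] ([balance]).  Exchanging p and q, that is alpha and
    beta, reflects the arc in the line x = -1/2, so that p / q may even be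
    taken in [1, alpha^-2] ([cyclic_basis]), which is exactly the part of the
    circle between the two endpoints ([unit_form_arc]).  Finally a change of
    basis moves the shape by an element of GL_2(Z) ([binary_shape_act]). *)

Import Order.TTheory GRing.Theory Num.Theory.
Local Open Scope classical_set_scope.
Local Open Scope complex_scope.
Local Open Scope ring_scope.

Local Notation normc := ComplexField.Normc.normc.

(** * Binary quadratic forms of discriminant 5 *)

Lemma centered_mod (A B : int) : A != 0 -> exists k, `|B + 2 * A * k| <= `|A|.
Proof.
move=> A0.
have [q [r [Bqr [r0 rA]]]] : exists q r, B + `|A| = q * (2 * `|A|) + r /\ 0 <= r /\ r < 2 * `|A|.
  exists ((B + `|A|) %/ (2 * `|A|))%Z, ((B + `|A|) %% (2 * `|A|))%Z.
  have A2 : 2 * `|A| != 0 by lia.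
  split; first exact: divz_eq.
  split; first exact: modz_ge0.
  by apply: ltz_pmod; lia.
exists (- q * Num.sg A).
have -> : 2 * A * (- q * Num.sg A) = - (q * (2 * `|A|)) by rewrite normrEsg; ring.
lia.
Qed.

Lemma sqr_neq5 (B : int) : B ^+ 2 <> 5.
Proof.
rewrite -(real_normK (num_real B)); have := normr_ge0 B; move: `|B| => b b0 b5.
have b3 : b < 3 by nia.
have : b = 0 \/ b = 1 \/ b = 2 by lia.
by case=> [|[|]] bE; rewrite bE in b5.
Qed.

(** Gauss reduction: shifting x by a multiple of y makes |B| <= |A|, and then
    4 |A C| <= A^2 + 4, so |C| < |A| as soon as |A| >= 2.  Exchanging A and C
    therefore decreases the first coefficient until it is 1 or -1; it never
    becomes 0 because 5 is not a square. *)
Lemma form5_represents_unit (A B C : int) :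
  B ^+ 2 - 4 * A * C = 5 ->
  exists x y : int, (A * x ^+ 2 + B * x * y + C * y ^+ 2) ^+ 2 = 1.
Proof.
(* The induction hypothesis is applied to (C', B', A), whose variables are
   exchanged; this explains the witness below. *)
move: {2}`|A|%N (leqnn `|A|%N) => n; elim: n A B C => [|n IH] A B C An disc.
  have A0 : A = 0 by lia.
  by rewrite A0 mulr0 mul0r subr0 in disc; case: (sqr_neq5 B).
have [A1|A1] := leqP `|A|%N 1.
  have A0 : A != 0.
    by apply/eqP => A0; rewrite A0 mulr0 mul0r subr0 in disc; case: (sqr_neq5 B).
  exists 1, 0.
  have : A = 1 \/ A = - 1 by lia.
  by case=> ->; ring.
have [k kP] : exists k, `|B + 2 * A * k| <= `|A| by apply: centered_mod; lia.
pose B' := B + 2 * A * k; pose C' := A * k ^+ 2 + B * k + C.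
have disc' : B' ^+ 2 - 4 * C' * A = 5 by rewrite -disc /B' /C'; ring.
have C'A : (`|C'| <= n)%N.
  have : `|4 * C' * A| <= `|A| ^+ 2 + 4.
    have : B' ^+ 2 <= `|A| ^+ 2 by rewrite -(real_normK (num_real B')) lerXn2r ?nnegrE.
    have : 0 <= B' ^+ 2 by apply: sqr_ge0.
    have : (2 <= `|A|)%R by lia.
    by move: disc'; nia.
  rewrite !normrM => H; have : `|C'| < `|A| by nia.
  lia.
have [x [y xy]] := IH _ _ _ C'A disc'.
exists (y + k * x), x; rewrite -xy /B' /C'; ring.
Qed.

(** * The roots of t^2 + t - 1 *)

(** [alpha] and [beta] are 2 cos (2 pi / 5) and 2 cos (4 pi / 5), the values of
    r + r^-1 in the two irreducible representations of D_5 of dimension 2;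
    -[beta] = 1 / [alpha] is the golden ratio. *)
Definition alpha (R : realType) : R := (Num.sqrt 5 - 1) / 2.
Definition beta (R : realType) : R := (- Num.sqrt 5 - 1) / 2.

Lemma sqr_sqrt5 (R : realType) : (Num.sqrt 5 : R) ^+ 2 = 5.
Proof. by rewrite sqr_sqrtr. Qed.

Lemma alphaD (R : realType) : alpha R + beta R = - 1.
Proof. rewrite /alpha /beta; lra. Qed.

Lemma alphaM (R : realType) : alpha R * beta R = - 1.
Proof. by rewrite /alpha /beta; have := sqr_sqrt5 R; nra. Qed.

Lemma alpha_sqr (R : realType) : alpha R ^+ 2 = 1 - alpha R.
Proof. by rewrite /alpha; have := sqr_sqrt5 R; nra. Qed.

Lemma beta_sqr (R : realType) : beta R ^+ 2 = 1 - beta R.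
Proof. by rewrite /beta; have := sqr_sqrt5 R; nra. Qed.

Lemma alpha_itv (R : realType) : 1 / 2 < alpha R < 1.
Proof.
have := sqr_sqrt5 R; have := sqrtr_ge0 (5 : R); rewrite /alpha => s0 s5.
by apply/andP; split; nra.
Qed.

(** For p q > 0 this says that p / q lies between alpha^2 and alpha^-2, in a form
    that is visibly symmetric in p and q. *)
Definition balanced (R : realType) (p q : R) : Prop :=
  alpha R ^+ 2 * p ^+ 2 <= p * q /\ alpha R ^+ 2 * q ^+ 2 <= p * q.

(** The step (p, q) -> (alpha^2 p, beta^2 q) keeps p q and multiplies p / q by
    alpha^4 < 1/2.  It is iterated until p / q first drops below alpha^-2; the
    interval [alpha^2, alpha^-2] is exactly long enough not to be jumped over. *)
(** [S] stands for the pairs of eigencoordinates of the generators of a module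
    over Z[alpha].  Since alpha beta = -1, one multiplication by alpha corrects
    the sign of p q, and [balance_left], used for p / q or for q / p, does the
    rest. *)
Lemma balance_left (R : realType) (S : R -> R -> Prop) :
  (forall p q, S p q -> S (alpha R ^+ 2 * p) (beta R ^+ 2 * q)) ->
  forall p q, S p q -> 0 < p * q -> p * q <= alpha R ^+ 2 * p ^+ 2 ->
  exists p' q', [/\ S p' q', 0 < p' * q' & balanced R p' q'].
Proof.
have := alphaM R; have := alpha_itv R; rewrite /balanced.
set a := alpha R; set b := beta R => a_itv ab Sab p q Spq pq0.
have ab2 : a ^+ 2 * b ^+ 2 = 1 by rewrite -exprMn ab sqrrN expr1n.
have a_le1 : a ^+ 2 <= 1 by move/andP: a_itv => [a1 a2]; nra.
have b_ge0 : 0 <= b ^+ 2 := sqr_ge0 b.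
(* [n] bounds the number of iterations, as alpha^4 < 1/2. *)
have [n np] : exists n : nat, a ^+ 2 * p ^+ 2 <= 2 ^+ n * (p * q).
  exists (Num.bound (a ^+ 2 * p ^+ 2 / (p * q))); rewrite -ler_pdivrMr //.
  exact/ltW/upper_nthrootP.
have q_small x y : 0 < x * y -> x * y <= a ^+ 2 * x ^+ 2 -> y ^+ 2 <= a ^+ 2 * (x * y).
  move=> xy0 xy; have x0 : x != 0 by apply: contraTneq xy0 => ->; rewrite mul0r ltxx.
  have x2 : 0 < x ^+ 2 by rewrite exprn_even_gt0.
  rewrite -(ler_pM2l x2) -exprMn [leRHS](_ : _ = a ^+ 2 * x ^+ 2 * (x * y)); last by ring.
  by rewrite expr2 ler_pM2r.
elim: n p q Spq pq0 np => [|n IH] p q Spq pq0 np pq; have q2 := q_small p q pq0 pq.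
  exists p, q; split=> //; split; first by rewrite expr0 mul1r in np.
  apply: le_trans (_ : q ^+ 2 <= _); first by rewrite ler_piMl ?sqr_ge0.
  by apply: le_trans q2 _; rewrite ler_piMl // ltW.
have pqE : a ^+ 2 * p * (b ^+ 2 * q) = p * q by rewrite mulrACA ab2 mul1r.
have [le|gt] := leP (a ^+ 2 * (a ^+ 2 * p) ^+ 2) (p * q).
  exists (a ^+ 2 * p), (b ^+ 2 * q).
  rewrite pqE; split=> //; first exact: Sab.
  split=> //; rewrite [leLHS](_ : _ = (a ^+ 2 * b ^+ 2) * (b ^+ 2 * q ^+ 2)); last by ring.
  rewrite ab2 mul1r; apply: le_trans (ler_wpM2l b_ge0 q2) _.
  by rewrite [leLHS](_ : _ = a ^+ 2 * b ^+ 2 * (p * q)); [rewrite ab2 mul1r | ring].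
apply: (IH (a ^+ 2 * p) (b ^+ 2 * q)); first exact: Sab.
- by rewrite pqE.
- rewrite pqE.
  have a4 : (a ^+ 2) ^+ 2 <= 2^-1.
    rewrite alpha_sqr -/a; move/andP: a_itv => [a1 a2].
    by have := sqr_ge0 (a - 1/2); nra.
  rewrite [leLHS](_ : _ = (a ^+ 2) ^+ 2 * (a ^+ 2 * p ^+ 2)); last by ring.
  apply: (@le_trans _ _ (2^-1 * (a ^+ 2 * p ^+ 2))).
    by apply: ler_wpM2r a4; rewrite mulr_ge0 ?sqr_ge0.
  by rewrite (exprS 2 n) -(mulrA 2) in np; rewrite [leLHS]mulrC ler_pdivrMr // [leRHS]mulrC.
- by rewrite pqE ltW.
Qed.

Lemma balance (R : realType) (S : R -> R -> Prop) :
  (forall p q, S p q -> S (alpha R * p) (beta R * q)) ->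
  (forall p q, S p q -> S (beta R * p) (alpha R * q)) ->
  (forall p q, S p q -> p * q != 0) ->
  (exists p q, S p q) ->
  exists p q, [/\ S p q, 0 < p * q & balanced R p q].
Proof.
move=> Sa Sb S0 [p1 [q1 Spq1]].
have [p [q [Spq pq0]]] : exists p q, S p q /\ 0 < p * q.
  have := S0 _ _ Spq1; rewrite neq_lt => /orP[lt0|gt0]; last by exists p1, q1.
  exists (alpha R * p1), (beta R * q1); split; first exact: Sa.
  by rewrite mulrACA alphaM mulN1r oppr_gt0.
have [le1|gt1] := leP (p * q) (alpha R ^+ 2 * p ^+ 2).
  apply: balance_left Spq pq0 le1 => x y Sxy.
  rewrite (expr2 (alpha R)) (expr2 (beta R)) -(mulrA (alpha R)) -(mulrA (beta R)).
  exact: (Sa _ _ (Sa _ _ Sxy)).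
have [le2|gt2] := leP (q * p) (alpha R ^+ 2 * q ^+ 2).
  have [| |q' [p' [Sq' q'p' [b1 b2]]]] := @balance_left R (fun x y => S y x) _ q p Spq _ le2.
  - move=> x y Sxy.
    rewrite (expr2 (alpha R)) (expr2 (beta R)) -(mulrA (alpha R)) -(mulrA (beta R)).
    exact: (Sb _ _ (Sb _ _ Sxy)).
  - by rewrite mulrC.
  - by exists p', q'; rewrite /balanced ![p' * q']mulrC.
by exists p, q; split=> //; split; [exact: ltW | rewrite [p * q]mulrC ltW].
Qed.

(** The middle expression divided by the last one is x + 1/2, where x is the
    abscissa of the shape of the basis (v, alpha v); the inequalities say that
    x lies between -1/2 and 1/2. *)
Lemma reduced_abscissa_pos (R : realType) (p q : R) :
  0 < p -> q <= p -> alpha R ^+ 2 * p <= q ->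
  0 <= Num.sqrt 5 * 2 * (p ^+ 2 - q ^+ 2) <= 4 * p ^+ 2 + 4 * q ^+ 2 - 2 * (p * q).
Proof.
move=> p0 qp; have := alpha_itv R; have s5 := sqr_sqrt5 R; have := sqrtr_ge0 (5 : R).
rewrite alpha_sqr /alpha; move: s5; set s := Num.sqrt 5 => s5 s0 /andP[s1 s2] ap.
have q0 : 0 < q by nra.
apply/andP; split; first by nra.
(* In t = p / q the difference is a quadratic polynomial that vanishes at
   t = alpha^-2 = (sqrt 5 + 3) / 2; its other root is negative. *)
have -> : 4 * p ^+ 2 + 4 * q ^+ 2 - 2 * (p * q) =
   s * 2 * (p ^+ 2 - q ^+ 2) + ((s - 2) * p + (s + 1) / 2 * q) * ((s + 3) * q - 2 * p).
  have -> : s * 2 * (p ^+ 2 - q ^+ 2) + ((s - 2) * p + (s + 1) / 2 * q) * ((s + 3) * q - 2 * p)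
    = 4 * p ^+ 2 + (s ^+ 2 - 7) * (p * q) + ((s ^+ 2 + 3) / 2) * q ^+ 2 by field.
  by rewrite s5; field.
by rewrite lerDl mulr_ge0; nra.
Qed.

Lemma reduced_abscissa (R : realType) (p q : R) :
  0 < p * q -> q ^+ 2 <= p * q -> alpha R ^+ 2 * p ^+ 2 <= p * q ->
  0 <= Num.sqrt 5 * 2 * (p ^+ 2 - q ^+ 2) <= 4 * p ^+ 2 + 4 * q ^+ 2 - 2 * (p * q).
Proof.
move=> pq0 qp ap.
have reduce x y : 0 < x -> 0 < x * y -> y ^+ 2 <= x * y -> alpha R ^+ 2 * x ^+ 2 <= x * y ->
    0 <= Num.sqrt 5 * 2 * (x ^+ 2 - y ^+ 2) <= 4 * x ^+ 2 + 4 * y ^+ 2 - 2 * (x * y).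
  move=> x0; rewrite pmulr_rgt0 // => y0 yx ax; apply: reduced_abscissa_pos => //.
    by rewrite -(ler_pM2r y0) -expr2.
  by rewrite -(ler_pM2l x0) mulrCA -expr2.
have [p0|p0|p0] := ltgtP p 0; last by rewrite p0 mul0r ltxx in pq0.
  by have := reduce (- p) (- q); rewrite !sqrrN mulrNN oppr_gt0; apply.
exact: reduce.
Qed.

(** * Cyclic bases of rank 2 modules over Z[alpha] *)

(** The rows (p0, q0) and (p1, q1) are the eigencoordinates of a basis of a
    lattice, and M = (a, b; c, d) is the matrix of the operator with eigenvalues
    alpha and beta.  A vector v with coefficients (x, y) generates the lattice
    over Z[alpha] exactly when the form det (v, v M), which has discriminant 5,
    takes the value 1 or -1 at (x, y); multiplying v by a unit of Z[alpha]
    preserves this, so v may be balanced.  The new basis is (v, alpha v) or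
    (v, beta v), according to which of |p| and |q| is larger. *)
Lemma cyclic_basis (R : realType) (p0 q0 p1 q1 : R) (a b c d : int) :
  p0 * q1 - p1 * q0 != 0 ->
  alpha R * p0 = a%:~R * p0 + b%:~R * p1 ->
  alpha R * p1 = c%:~R * p0 + d%:~R * p1 ->
  beta R * q0 = a%:~R * q0 + b%:~R * q1 ->
  beta R * q1 = c%:~R * q0 + d%:~R * q1 ->
  exists x y z w : int, (x * w - y * z) ^+ 2 = 1 /\
    exists p q p' q' : R,
    [/\ [/\ p = x%:~R * p0 + y%:~R * p1, q = x%:~R * q0 + y%:~R * q1,
            p' = z%:~R * p0 + w%:~R * p1 & q' = z%:~R * q0 + w%:~R * q1],
        0 < p * q, balanced R p q
      & [/\ q ^+ 2 <= p * q, p' = alpha R * p & q' = beta R * q] \/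
        [/\ p ^+ 2 <= p * q, p' = beta R * p & q' = alpha R * q]].
Proof.
move=> D0 ap0 ap1 bq0 bq1.
have traceM : a + d = -1.
  apply: (@intr_inj R); rewrite intrD intrN -alphaD; apply: (mulIf D0).
  have -> : (alpha R + beta R) * (p0 * q1 - p1 * q0) =
    (alpha R * p0) * q1 - (alpha R * p1) * q0 + (beta R * q1) * p0 - (beta R * q0) * p1 by ring.
  by rewrite ap0 ap1 bq0 bq1; ring.
have detM : a * d - b * c = -1.
  apply: (@intr_inj R); rewrite intrB !intrM intrN -alphaM; apply: (mulIf D0).
  have -> : (alpha R * beta R) * (p0 * q1 - p1 * q0) =
    (alpha R * p0) * (beta R * q1) - (alpha R * p1) * (beta R * q0) by ring.
  by rewrite ap0 ap1 bq0 bq1; ring.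
(* As beta = -1 - alpha, the matrix of the conjugate operator is -1 - M. *)
have bp0 : beta R * p0 = - p0 - (a%:~R * p0 + b%:~R * p1).
  by rewrite -ap0 -[beta R](addKr (alpha R)) alphaD; ring.
have bp1 : beta R * p1 = - p1 - (c%:~R * p0 + d%:~R * p1).
  by rewrite -ap1 -[beta R](addKr (alpha R)) alphaD; ring.
have aq0 : alpha R * q0 = - q0 - (a%:~R * q0 + b%:~R * q1).
  by rewrite -bq0 -[alpha R](addrK (beta R)) alphaD; ring.
have aq1 : alpha R * q1 = - q1 - (c%:~R * q0 + d%:~R * q1).
  by rewrite -bq1 -[alpha R](addrK (beta R)) alphaD; ring.
(* f x y is the determinant of the rows (x, y) and (x, y) M; its discriminant is
   that of the characteristic polynomial t^2 + t - 1 of M. *)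
pose f (x y : int) := x * (b * x + d * y) - y * (a * x + c * y).
pose S p q := exists x y : int,
  [/\ f x y ^+ 2 = 1, p = x%:~R * p0 + y%:~R * p1 & q = x%:~R * q0 + y%:~R * q1].
have S_alpha p q : S p q -> S (alpha R * p) (beta R * q).
  move=> [x [y [fxy -> ->]]]; exists (a * x + c * y), (b * x + d * y); split.
  - rewrite -fxy /f.
    have -> : (a * x + c * y) * (b * (a * x + c * y) + d * (b * x + d * y))
      - (b * x + d * y) * (a * (a * x + c * y) + c * (b * x + d * y)) =
      (a * d - b * c) * (x * (b * x + d * y) - y * (a * x + c * y)) by ring.
    by rewrite detM mulN1r sqrrN.
  - rewrite mulrDr (mulrCA (alpha R)) ap0 (mulrCA (alpha R)) ap1; ring.
  - rewrite mulrDr (mulrCA (beta R)) bq0 (mulrCA (beta R)) bq1; ring.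
have S_beta p q : S p q -> S (beta R * p) (alpha R * q).
  move=> [x [y [fxy -> ->]]]; exists (- x - (a * x + c * y)), (- y - (b * x + d * y)); split.
  - rewrite -fxy /f; set X := - x - _; set Y := - y - _.
    have -> : X * (b * X + d * Y) - Y * (a * X + c * Y) =
      (a * d - b * c + (a + d) + 1) * (x * (b * x + d * y) - y * (a * x + c * y))
      by rewrite /X /Y; ring.
    by rewrite detM traceM mulN1r sqrrN.
  - rewrite mulrDr (mulrCA (beta R)) bp0 (mulrCA (beta R)) bp1; ring.
  - rewrite mulrDr (mulrCA (alpha R)) aq0 (mulrCA (alpha R)) aq1; ring.
have S_neq0 p q : S p q -> p * q != 0.
  move=> [x [y [fxy pE qE]]]; apply/eqP => pq0.
  have f0 : (f x y)%:~R * (p0 * q1 - p1 * q0) = 0.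
    have -> : (f x y)%:~R * (p0 * q1 - p1 * q0) = p * (beta R * q) - q * (alpha R * p).
      rewrite pE qE !mulrDr (mulrCA (alpha R)) ap0 (mulrCA (alpha R)) ap1.
      by rewrite (mulrCA (beta R)) bq0 (mulrCA (beta R)) bq1 /f; ring.
    by rewrite mulrCA pq0 [q * _]mulrCA [q * p]mulrC pq0 !mulr0 subrr.
  by move/eqP: f0; rewrite mulf_eq0 (negPf D0) orbF intr_eq0 => /eqP f0; rewrite f0 in fxy.
have [x0 [y0 xy0]] : exists x y, f x y ^+ 2 = 1.
  have [|x [y xy]] := form5_represents_unit b (d - a) (- c).
    have -> : (d - a) ^+ 2 - 4 * b * - c = (a + d) ^+ 2 - 4 * (a * d - b * c) by ring.
    by rewrite traceM detM.
  by exists x, y; rewrite -xy /f; ring.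
have S_ex : exists p q, S p q.
  by exists (x0%:~R * p0 + y0%:~R * p1), (x0%:~R * q0 + y0%:~R * q1), x0, y0.
have [p [q [Spq pq0 bal]]] := balance R S S_alpha S_beta S_neq0 S_ex.
have [x [y [fxy pE qE]]] := Spq.
have [qp|pq] := lerP (q ^+ 2) (p * q).
  exists x, y, (a * x + c * y), (b * x + d * y); split.
    by rewrite -fxy /f; ring.
  exists p, q, (alpha R * p), (beta R * q); split=> //; last by left.
  split=> //.
  - rewrite pE mulrDr (mulrCA (alpha R)) ap0 (mulrCA (alpha R)) ap1; ring.
  - rewrite qE mulrDr (mulrCA (beta R)) bq0 (mulrCA (beta R)) bq1; ring.
exists x, y, (- x - (a * x + c * y)), (- y - (b * x + d * y)); split.
  by rewrite -fxy /f; ring.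
exists p, q, (beta R * p), (alpha R * q); split=> //.
  split=> //.
  - rewrite pE mulrDr (mulrCA (beta R)) bp0 (mulrCA (beta R)) bp1; ring.
  - rewrite qE mulrDr (mulrCA (alpha R)) aq0 (mulrCA (alpha R)) aq1; ring.
right; split=> //.
have q0' : q != 0 by apply: contraTneq pq0 => ->; rewrite mulr0 ltxx.
have q2 : 0 < q ^+ 2 by rewrite exprn_even_gt0.
rewrite -(ler_pM2r q2) [leLHS](_ : _ = p * q * (p * q)); last by ring.
by rewrite ler_pM2l // ltW.
Qed.

(** * The action of GL_2(Z) and shapes of binary forms *)

Lemma sum_ord2 (V : nmodType) (F : 'I_2 -> V) : \sum_(i < 2) F i = F 0 + F 1.
Proof.
rewrite !big_ord_recl big_ord0 addr0; congr (_ + F _).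
exact: val_inj.
Qed.

Lemma det_mx2 (A : comNzRingType) (g : 'M[A]_2) : \det g = g 0 0 * g 1 1 - g 0 1 * g 1 0.
Proof.
rewrite (expand_det_row _ 0) !big_ord_recl big_ord0 addr0 /cofactor !det_mx11 !mxE /=.
rewrite expr0 expr1 mul1r mulN1r mulrN.
by congr (g _ _ * g _ _ - g _ _ * g _ _); apply: val_inj.
Qed.

Lemma GL2Z_det (g : 'M[int]_2) : g \in unitmx -> \det g = 1 \/ \det g = -1.
Proof. by rewrite unitmxE qualifE /= => /orP[] /eqP ->; [left | right]. Qed.

Lemma intr_complex (R : realType) (n : int) : (n%:~R : R[i]) = n%:~R%:C.
Proof. by rewrite -(rmorph_int (real_complex R)). Qed.

(** A row of an invertible matrix is not zero, and a number that is not real is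
    not a root of a nonzero real polynomial of degree at most 1. *)
Lemma denominator_neq0 (R : realType) (g : 'M[int]_2) (z : R[i]) :
  g \in unitmx -> complex.Im z != 0 -> (g 1 0)%:~R * z + (g 1 1)%:~R != 0.
Proof.
move=> g_unit z0; apply: contraTneq g_unit.
rewrite !intr_complex; case: z z0 => x y /= y0 /eqP.
rewrite eq_complex /= !mul0r !addr0 subr0 mulf_eq0 (negPf y0) orbF => /andP[/[swap]].
rewrite intr_eq0 => /eqP c0; rewrite c0 mul0r add0r intr_eq0 => /eqP d0.
by rewrite unitmxE det_mx2 c0 d0 !mulr0 subrr.
Qed.

(** The part common to the two cases of [GL2Z_act], which precomposes it with
    conjugation when the determinant is -1. *)
Definition moebius (R : realType) (g : 'M[int]_2) (z : R[i]) : R[i] :=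
  ((g 0 0)%:~R * z + (g 0 1)%:~R) / ((g 1 0)%:~R * z + (g 1 1)%:~R).

Lemma conjc_moebius (R : realType) (g : 'M[int]_2) (z : R[i]) :
  conjc (moebius R g z) = moebius R g (conjc z).
Proof. by rewrite /moebius !(fmorph_div, rmorphD, rmorphM, rmorph_int). Qed.

Lemma moebius_comp (R : realType) (h g : 'M[int]_2) (z : R[i]) :
  g \in unitmx -> complex.Im z != 0 -> moebius R h (moebius R g z) = moebius R (h *m g) z.
Proof.
move=> g_unit z0; have den0 := denominator_neq0 R g z g_unit z0.
rewrite /moebius; set u := (g 0 0)%:~R * z + _; set v := _ + _ in den0 *.
have mulE i : ((h *m g) i 0)%:~R * z + ((h *m g) i 1)%:~R = (h i 0)%:~R * u + (h i 1)%:~R * v.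
  by rewrite !mxE !sum_ord2 /u /v !(intrD, intrM); ring.
rewrite !mulE.
have divE (a b : R[i]) : a * (u / v) + b = (a * u + b * v) / v by field.
by rewrite !divE invfM invrK mulrACA mulVf ?mulr1.
Qed.

Lemma GL2Z_actE (R : realType) (g : 'M[int]_2) (z : R[i]) :
  GL2Z_act g z = moebius R g (if \det g == 1 then z else conjc z).
Proof. by []. Qed.

(** Matrices with integer entries commute with conjugation, so the conjugations
    attached to the two determinants can be collected on z. *)
Lemma GL2Z_act_comp (R : realType) (h g : 'M[int]_2) (z : R[i]) :
  h \in unitmx -> g \in unitmx -> complex.Im z != 0 ->
  GL2Z_act h (GL2Z_act g z) = GL2Z_act (h *m g) z.
Proof.
move=> h_unit g_unit z0; rewrite !GL2Z_actE det_mulmx.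
have zc0 : complex.Im (conjc z) != 0 by case: z z0 => x y /=; rewrite oppr_eq0.
by case: (GL2Z_det h h_unit) => ->; case: (GL2Z_det g g_unit) => -> /=;
  rewrite ?conjc_moebius ?conjcK moebius_comp.
Qed.

Lemma GL2Z_orbit_act (R : realType) (g : 'M[int]_2) (z : R[i]) :
  g \in unitmx -> complex.Im z != 0 -> GL2Z_orbit (GL2Z_act g z) = GL2Z_orbit z.
Proof.
move=> g_unit z0; apply/seteqP; split=> _ [h /= h_unit <-].
  by exists (h *m g); rewrite /= ?unitmx_mul ?h_unit // GL2Z_act_comp.
exists (h *m invmx g); first by rewrite /= unitmx_mul h_unit unitmx_inv.
by rewrite GL2Z_act_comp ?unitmx_mul ?h_unit ?unitmx_inv // mulmxKV.
Qed.

(** The shape of the lattice with Gram matrix (a, b; b, c). *)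
Definition binary_shape (R : realType) (a b c : R) : R[i] :=
  (b / a) +i* Num.sqrt (c / a - (b / a) ^+ 2).

(** If v0, v1 have shape tau, so that v1 / v0 is tau up to conjugation, then
    (z v0 + w v1) / (x v0 + y v1) is (w tau + z) / (y tau + x): the change of
    basis (x, y; z, w) acts on shapes by this matrix. *)
Definition swap_mx (x y z w : int) : 'M[int]_2 :=
  \matrix_(i, j) if i == 0 then (if j == 0 then w else z) else (if j == 0 then y else x).

Lemma swap_mx_det (x y z w : int) : \det (swap_mx x y z w) = x * w - y * z.
Proof. by rewrite det_mx2 !mxE /=; ring. Qed.

Lemma swap_mx_unit (x y z w : int) : (x * w - y * z) ^+ 2 = 1 -> swap_mx x y z w \in unitmx.
Proof.
by rewrite unitmxE swap_mx_det => det1; apply/unitrPr; exists (x * w - y * z); rewrite -expr2.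
Qed.

(** With tau = xi + i eta and n = |x + y tau|^2, the new first coefficient is
    a n and the new ordinate is eta / n, because the discriminant is preserved.
    The conjugation in the action occurs when the determinant d is -1, so that
    the acting point is xi + i d eta in both cases. *)
Lemma binary_shape_act (R : realType) (a b c : R) (x y z w : int) :
  0 < a -> 0 < a * c - b ^+ 2 -> (x * w - y * z) ^+ 2 = 1 ->
  let X : R := x%:~R in let Y : R := y%:~R in let Z : R := z%:~R in let W : R := w%:~R in
  binary_shape R (X ^+ 2 * a + 2 * X * Y * b + Y ^+ 2 * c)
    (X * Z * a + (X * W + Y * Z) * b + Y * W * c)
    (Z ^+ 2 * a + 2 * Z * W * b + W ^+ 2 * c)
  = GL2Z_act (swap_mx x y z w) (binary_shape R a b c).
Proof.
move=> a0 disc det1 X Y Z W; rewrite {2}/binary_shape.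
set xi := b / a; set eta := Num.sqrt _.
have aN0 : a != 0 by rewrite gt_eqF.
have eta2 : eta ^+ 2 = c / a - xi ^+ 2.
  rewrite sqr_sqrtr //; have -> : c / a - xi ^+ 2 = (a * c - b ^+ 2) / a ^+ 2 by rewrite /xi; field.
  by rewrite divr_ge0 ?exprn_ge0 ?ltW.
have eta0 : 0 < eta.
  rewrite sqrtr_gt0; have -> : c / a - xi ^+ 2 = (a * c - b ^+ 2) / a ^+ 2 by rewrite /xi; field.
  by rewrite divr_gt0 ?exprn_gt0.
have bE : b = a * xi by rewrite /xi; field.
have cE : c = a * (xi ^+ 2 + eta ^+ 2) by rewrite eta2; field.
pose d := X * W - Y * Z.
have d2 : d ^+ 2 = 1 by rewrite /d -!intrM -intrB -rmorphXn /= det1.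
pose n := (X + Y * xi) ^+ 2 + Y ^+ 2 * eta ^+ 2.
have n0 : 0 < n.
  rewrite lt_def; apply/andP; split; last by rewrite /n -exprMn addr_ge0 ?sqr_ge0.
  rewrite /n -exprMn paddr_eq0 ?sqr_ge0 // !sqrf_eq0 mulf_eq0 (gt_eqF eta0) orbF.
  apply/negP => /andP[/[swap]/eqP Y0]; rewrite Y0 mul0r addr0 => /eqP X0.
  by move/eqP: d2; rewrite /d X0 Y0 !mul0r subrr expr0n eq_sym oner_eq0.
have nN0 : n != 0 by rewrite gt_eqF.
have aE : X ^+ 2 * a + 2 * X * Y * b + Y ^+ 2 * c = a * n by rewrite bE cE /n; ring.
pose m := X * Z + (X * W + Y * Z) * xi + Y * W * (xi ^+ 2 + eta ^+ 2).
have mE : X * Z * a + (X * W + Y * Z) * b + Y * W * c = a * m by rewrite bE cE /m; ring.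
have rE : a * m / (a * n) = m / n by field; rewrite nN0 aN0.
have -> : binary_shape R (X ^+ 2 * a + 2 * X * Y * b + Y ^+ 2 * c)
    (X * Z * a + (X * W + Y * Z) * b + Y * W * c)
    (Z ^+ 2 * a + 2 * Z * W * b + W ^+ 2 * c) = (m / n) +i* (eta / n).
  rewrite /binary_shape aE mE rE.
  have -> : (Z ^+ 2 * a + 2 * Z * W * b + W ^+ 2 * c) / (a * n) - (m / n) ^+ 2
      = (eta / n) ^+ 2.
    have -> : (eta / n) ^+ 2 = (eta ^+ 2 * d ^+ 2) / n ^+ 2 by rewrite d2; field.
    have -> : Z ^+ 2 * a + 2 * Z * W * b + W ^+ 2 * c =
      a * ((Z + W * xi) ^+ 2 + W ^+ 2 * eta ^+ 2) by rewrite bE cE; ring.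
    have key : ((Z + W * xi) ^+ 2 + W ^+ 2 * eta ^+ 2) * n - m ^+ 2 = eta ^+ 2 * d ^+ 2.
      by rewrite /n /m /d; ring.
    by rewrite -key; field; rewrite nN0 aN0.
  by rewrite sqrtr_sqr ger0_norm // divr_ge0 ?ltW.
rewrite GL2Z_actE.
have -> : (if \det (swap_mx x y z w) == 1 then xi +i* eta else conjc (xi +i* eta))
    = xi +i* (d * eta).
  rewrite swap_mx_det /d -!intrM -intrB.
  case: (GL2Z_det _ (swap_mx_unit _ _ _ _ det1)); rewrite swap_mx_det => ->.
    by rewrite eqxx mul1r.
  by rewrite /= mulN1r.
have tau0 : complex.Im (xi +i* (d * eta)) != 0.
  by rewrite /= mulf_neq0 ?(gt_eqF eta0) // -sqrf_eq0 d2 oner_eq0.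
have den0 := denominator_neq0 R _ _ (swap_mx_unit _ _ _ _ det1) tau0.
apply: (mulIf den0); rewrite /moebius divfK //.
rewrite !mxE /= !intr_complex -/X -/Y -/Z -/W.
apply/eqP; rewrite eq_complex /= !mul0r !addr0 !subr0.
apply/andP; split; apply/eqP.
  apply: (mulIf nN0).
  have -> : (m / n * (Y * xi + X) - eta / n * (Y * (d * eta))) * n
    = m * (Y * xi + X) - eta ^+ 2 * Y * d by field.
  by rewrite /m /n /d; ring.
apply: (mulIf nN0).
have -> : (m / n * (Y * (d * eta)) + eta / n * (Y * xi + X)) * n
  = m * Y * d * eta + d ^+ 2 * eta * (Y * xi + X) by rewrite d2; field.
by rewrite /m /n /d; ring.
Qed.

(** * The quadratic form of the unit lattice *)

(** The polar form of 4 p^2 + 4 q^2 - 2 p q. *)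
Definition unit_form (R : realType) (p q p' q' : R) : R :=
  4 * (p * p') + 4 * (q * q') - (p * q' + p' * q).

Lemma unit_form_circle (R : realType) (s3 s5 p q A E : R) :
  s3 ^+ 2 = 3 -> s5 ^+ 2 = 5 -> s3 != 0 -> A != 0 ->
  A = 4 * p ^+ 2 + 4 * q ^+ 2 - 2 * (p * q) -> E = s5 * 2 * (p ^+ 2 - q ^+ 2) ->
  (E / A) ^+ 2 + (5 * s3 * (p * q) / A - 1 / (2 * s3)) ^+ 2 = (2 / s3) ^+ 2.
Proof.
move=> s3E s5E s30 A0 AE EE.
apply: (mulIf (_ : 4 * s3 ^+ 2 * A ^+ 2 != 0)).
  by rewrite !mulf_neq0 ?expf_neq0 ?pnatr_eq0.
transitivity (4 * s3 ^+ 2 * E ^+ 2 + (10 * s3 ^+ 2 * (p * q) - A) ^+ 2).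
  by field; rewrite A0 s30.
transitivity (16 * A ^+ 2); last by field; rewrite s30.
by rewrite s3E EE exprMn exprMn s5E AE; ring.
Qed.

(** For A = 4 p^2 + 4 q^2 - 2 p q the shape of the basis (v, alpha v) is
    x + 1/2 = 2 sqrt 5 (p^2 - q^2) / A and y = 5 sqrt 3 p q / A, the ordinate
    being read off from the discriminant 75 p^2 q^2 of the Gram matrix. *)
Lemma unit_form_arc (R : realType) (p q : R) :
  0 < p * q -> q ^+ 2 <= p * q -> alpha R ^+ 2 * p ^+ 2 <= p * q ->
  let a := alpha R in let b := beta R in
  circle_arc (binary_shape R (unit_form R p q p q) (unit_form R p q (a * p) (b * q))
    (unit_form R (a * p) (b * q) (a * p) (b * q))).
Proof.
move=> pq0 qp ap a b.
have /andP[E0 EA] := reduced_abscissa R p q pq0 qp ap.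
set A := unit_form R p q p q.
have AE : A = 4 * p ^+ 2 + 4 * q ^+ 2 - 2 * (p * q) by rewrite /A /unit_form; ring.
rewrite -AE in EA; set E := _ * _ * _ in E0 EA.
have A0 : 0 < A.
  have -> : A = (p - q) ^+ 2 + 3 * p ^+ 2 + 3 * q ^+ 2 by rewrite AE; ring.
  have p0 : p != 0 by apply: contraTneq pq0 => ->; rewrite mul0r ltxx.
  have p2 : 0 < p ^+ 2 by rewrite exprn_even_gt0.
  by have := sqr_ge0 (p - q); have := sqr_ge0 q; lra.
have AN0 : A != 0 by rewrite gt_eqF.
have s3 : (Num.sqrt 3 : R) ^+ 2 = 3 by rewrite sqr_sqrtr.
have s30 : 0 < (Num.sqrt 3 : R) by rewrite sqrtr_gt0.
have absc : unit_form R p q (a * p) (b * q) / A = E / A - 1 / 2.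
  have -> : unit_form R p q (a * p) (b * q)
    = 4 * a * p ^+ 2 + 4 * b * q ^+ 2 - (a + b) * (p * q).
    by rewrite /unit_form; ring.
  apply: (mulIf AN0); rewrite divfK //.
  have -> : (E / A - 1 / 2) * A = E - A / 2 by field.
  by rewrite AE /E /a /b /alpha /beta; field.
have ord : Num.sqrt (unit_form R (a * p) (b * q) (a * p) (b * q) / A
    - (unit_form R p q (a * p) (b * q) / A) ^+ 2) = 5 * Num.sqrt 3 * (p * q) / A.
  have -> : unit_form R (a * p) (b * q) (a * p) (b * q) / A
    - (unit_form R p q (a * p) (b * q) / A) ^+ 2 = (5 * Num.sqrt 3 * (p * q) / A) ^+ 2.
    rewrite absc.
    have -> : unit_form R (a * p) (b * q) (a * p) (b * q) =
      4 * a ^+ 2 * p ^+ 2 + 4 * b ^+ 2 * q ^+ 2 - 2 * (a * b) * (p * q) by rewrite /unit_form; ring.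
    rewrite alpha_sqr beta_sqr alphaM.
    apply: (mulIf (_ : A ^+ 2 != 0)); first by rewrite expf_neq0.
    have -> : (5 * Num.sqrt 3 * (p * q) / A) ^+ 2 * A ^+ 2
      = 25 * Num.sqrt 3 ^+ 2 * (p * q) ^+ 2 by field.
    rewrite s3.
    have -> (X : R) : (X / A - (E / A - 1 / 2) ^+ 2) * A ^+ 2 = X * A - (E - A / 2) ^+ 2 by field.
    rewrite AE /E /alpha /beta; have := sqr_sqrt5 R; set s5 := Num.sqrt 5 => s5E.
    have -> : (s5 * 2 * (p ^+ 2 - q ^+ 2) - (4 * p ^+ 2 + 4 * q ^+ 2 - 2 * (p * q)) / 2) ^+ 2 =
      4 * s5 ^+ 2 * (p ^+ 2 - q ^+ 2) ^+ 2
      - 4 * s5 * (p ^+ 2 - q ^+ 2) * (2 * p ^+ 2 + 2 * q ^+ 2 - (p * q))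
      + (2 * p ^+ 2 + 2 * q ^+ 2 - (p * q)) ^+ 2 by field.
    by rewrite s5E; field.
  by rewrite sqrtr_sqr ger0_norm // ltW // divr_gt0 // mulr_gt0 // mulr_gt0.
rewrite /binary_shape ord absc; split.
- by rewrite /upper_half_plane /= divr_gt0 // mulr_gt0 // mulr_gt0.
- rewrite /on_circle /= subrK.
  exact: (unit_form_circle R _ _ p q A E s3 (sqr_sqrt5 R) (lt0r_neq0 s30) AN0 AE erefl).
- rewrite /=; have : 0 <= E / A by rewrite divr_ge0 // ltW.
  have : E / A <= 1 by rewrite ler_pdivrMr // mul1r.
  by move=> *; apply/andP; split; lra.
Qed.

(** The rows are the eigenvectors, for alpha and beta, of the operator that
    r + r^-1 induces on the vectors (a0, 2 a1, 2 a2); [j1] is the index of the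
    coordinate 2 a1. *)
Definition eigen_mx (R : realType) (r1 s : nat) (j1 : 'I_s) : 'M[R]_(2, r1 + s) :=
  row_mx (const_mx 1) (\matrix_(k, j) if (j == j1) == (k == 0) then alpha R else beta R).

Lemma mul_eigen_mxl (R : realType) (r1 s m : nat) (j1 : 'I_s) (C : 'M[R]_(m, 2)) i (k : 'I_r1) :
  (C *m eigen_mx R r1 s j1) i (lshift s k) = C i 0 + C i 1.
Proof.
by rewrite mxE sum_ord2 !row_mxEl !mxE !mulr1.
Qed.

Lemma mul_eigen_mxr (R : realType) (r1 s m : nat) (j1 : 'I_s) (C : 'M[R]_(m, 2)) i (j : 'I_s) :
  (C *m eigen_mx R r1 s j1) i (rshift r1 j) =
  if j == j1 then C i 0 * alpha R + C i 1 * beta R else C i 0 * beta R + C i 1 * alpha R.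
Proof.
by rewrite mxE sum_ord2 !row_mxEr !mxE /=; case: (j == j1).
Qed.

(** The eigenvectors (1, alpha, beta) and (1, beta, alpha) have squared norm
    1 + alpha^2 + beta^2 = 4 and inner product 1 + 2 alpha beta = -1. *)
Lemma gram_eigen_mx (R : realType) (r1 s : nat) (i0 : 'I_r1) (j1 j2 : 'I_s) (C : 'M[R]_2) i k :
  (forall i, i = i0) -> j2 != j1 -> (forall j, j = j1 \/ j = j2) ->
  gram (C *m eigen_mx R r1 s j1) i k = unit_form R (C i 0) (C i 1) (C k 0) (C k 1).
Proof.
move=> i0_uniq j21 j12.
rewrite /gram mxE big_split_ord /= (bigD1 i0) //= big1 => [|l]; last first.
  by rewrite (i0_uniq l) eqxx.
rewrite [X in _ + X](bigD1 j1) //= [X in _ + (_ + X)](bigD1 j2) //=.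
rewrite [X in _ + (_ + (_ + X))]big1 => [|j]; last first.
  by case: (j12 j) => ->; rewrite ?eqxx ?andbF.
rewrite ![_^T _ _]mxE !mul_eigen_mxl !mul_eigen_mxr eqxx (negPf j21) !addr0.
set p := C i 0; set q := C i 1; set p' := C k 0; set q' := C k 1.
have -> : (p + q) * (p' + q') + ((p * alpha R + q * beta R) * (p' * alpha R + q' * beta R)
    + (p * beta R + q * alpha R) * (p' * beta R + q' * alpha R)) =
   (1 + alpha R ^+ 2 + beta R ^+ 2) * (p * p' + q * q')
    + (1 + 2 * (alpha R * beta R)) * (p * q' + p' * q) by ring.
rewrite alpha_sqr beta_sqr alphaM.
have -> : 1 + (1 - alpha R) + (1 - beta R) = 3 - (alpha R + beta R) by ring.
by rewrite alphaD /unit_form; ring.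
Qed.

(** A lattice spanned by C times the two eigenvectors and stable under the
    operator has its shape on the arc: [cyclic_basis] provides a basis on which
    [unit_form_arc] applies, after exchanging p and q if it is (v, beta v). *)
Lemma eigen_shape (R : realType) (r1 s : nat) (i0 : 'I_r1) (j1 j2 : 'I_s) (C : 'M[R]_2)
    (M : 'M[int]_2) :
  (forall i, i = i0) -> j2 != j1 -> (forall j, j = j1 \/ j = j2) ->
  \det C != 0 ->
  (forall i, alpha R * C i 0 = (M i 0)%:~R * C 0 0 + (M i 1)%:~R * C 1 0) ->
  (forall i, beta R * C i 1 = (M i 0)%:~R * C 0 1 + (M i 1)%:~R * C 1 1) ->
  (@GL2Z_orbit R @` @circle_arc R) (shape_class (C *m eigen_mx R r1 s j1)).
Proof.
move=> i0_uniq j21 j12 C0 Malpha Mbeta.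
have D0 : C 0 0 * C 1 1 - C 1 0 * C 0 1 != 0 by rewrite [C 1 0 * _]mulrC -det_mx2.
have [x [y [z [w [det1 [p [q [p' [q' [[pE qE p'E q'E] pq0 [bal1 bal2] reduced]]]]]]]]]] :=
  cyclic_basis R _ _ _ _ _ _ _ _ D0 (Malpha 0) (Malpha 1) (Mbeta 0) (Mbeta 1).
exists (binary_shape R (unit_form R p q p q) (unit_form R p q p' q') (unit_form R p' q' p' q')).
  case: reduced => [[le -> ->]|[le -> ->]]; first exact: unit_form_arc.
  have sym u v u' v' : unit_form R u v u' v' = unit_form R v u v' u' by rewrite /unit_form; ring.
  by rewrite !(sym p) !(sym (beta R * p)); apply: unit_form_arc; rewrite [q * p]mulrC.
rewrite /shape_class /shape_point !(gram_eigen_mx R r1 s i0 j1 j2) //.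
set p0 := C 0 0; set q0 := C 0 1; set p1 := C 1 0; set q1 := C 1 1.
set a := unit_form R p0 q0 p0 q0; set b := unit_form R p0 q0 p1 q1.
set c := unit_form R p1 q1 p1 q1.
have disc : a * c - b ^+ 2 = 15 * (p0 * q1 - p1 * q0) ^+ 2.
  by rewrite /a /b /c /unit_form; ring.
have disc0 : 0 < a * c - b ^+ 2 by rewrite disc mulr_gt0 // exprn_even_gt0.
have a0 : 0 < a.
  have a_ge0 : 0 <= a.
    have -> : a = (p0 - q0) ^+ 2 + 3 * p0 ^+ 2 + 3 * q0 ^+ 2 by rewrite /a /unit_form; ring.
    by have := sqr_ge0 (p0 - q0); have := sqr_ge0 p0; have := sqr_ge0 q0; lra.
  rewrite lt_def a_ge0 andbT; apply: contraTneq disc0 => ->.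
  by rewrite mul0r sub0r oppr_gt0 -leNgt sqr_ge0.
have act := binary_shape_act R a b c x y z w a0 disc0 det1.
have -> : binary_shape R (unit_form R p q p q) (unit_form R p q p' q') (unit_form R p' q' p' q')
    = GL2Z_act (swap_mx x y z w) (binary_shape R a b c).
  rewrite -act /a /b /c; congr (binary_shape R _ _ _);
    by rewrite ?p'E ?q'E ?pE ?qE /unit_form /p0 /q0 /p1 /q1; ring.
rewrite GL2Z_orbit_act //; first exact: swap_mx_unit.
rewrite /= gt_eqF // sqrtr_gt0.
have -> : c / a - (b / a) ^+ 2 = (a * c - b ^+ 2) / a ^+ 2 by field; rewrite gt_eqF.
by rewrite divr_gt0 ?exprn_gt0.
Qed.

(** * Embeddings of number fields *)

Lemma rat_ext_primitive (K : fieldExtType rat) :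
  exists w : K, forall x, exists p : {poly rat}, x = (map_poly (in_alg K) p).[w].
Proof.
have chK : [pchar K] =i pred0 by move=> p; rewrite pchar_lalg pchar_num.
have sepK : separable 1%AS {:K}%AS by apply/separableP => x _; exact: pcharf0_separable.
have dK := eq_adjoin_separable_generator sepK (sub1v _).
exists (separable_generator 1 {:K}) => x.
have : x \in {:K}%VS by rewrite memvf.
rewrite /= dK => /Fadjoin_polyP[p /polyOver1P[q ->] ->].
by exists q.
Qed.

Lemma horner_rmorph_rat (K : fieldExtType rat) (F : numFieldType)
    (e : {rmorphism K -> F}) (p : {poly rat}) (w : K) :
  e (map_poly (in_alg K) p).[w] = (map_poly ratr p).[e w].
Proof.
rewrite -horner_map -map_poly_comp; congr (_ .[ _ ]); apply: eq_map_poly => a /=.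
exact: (fmorph_eq_rat (e \o in_alg K)).
Qed.

(** [K] is generated by one element [w]; sending [w] to a root of its minimal
    polynomial defines the embedding. *)
Lemma rat_ext_embedding (K : fieldExtType rat) (C : numClosedFieldType) :
  inhabited {rmorphism K -> C}.
Proof.
have [w genw] := rat_ext_primitive K.
have [m mE] : exists m, minPoly 1 w = map_poly (in_alg K) m.
  by have /polyOver1P := minPolyOver 1 w.
have size_m : (1 < size m)%N.
  by rewrite -(size_map_poly (in_alg K)) -mE size_minPoly.
have m_min p : (map_poly (in_alg K) p).[w] = 0 -> m %| p.
  move=> pw0; rewrite -(dvdp_map (in_alg K)) -mE minPoly_dvdp //; last exact/rootP.
  by apply/polyOver1P; exists p.
have [z /rootP mz0] : exists z : C, root (map_poly ratr m) z.
  by apply: closed_rootP; rewrite size_map_poly; case: (size m) size_m => [|[]].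
have poly_of x : {p : {poly rat} | x = (map_poly (in_alg K) p).[w]}.
  exact: boolp.cid.
(* A polynomial expression of [x] in [w] is chosen; [fE] shows that the choice
   does not matter. *)
pose f x := (map_poly ratr (sval (poly_of x))).[z] : C.
have fE p : f (map_poly (in_alg K) p).[w] = (map_poly ratr p).[z].
  rewrite /f; case: (poly_of _) => q /= /esym pq.
  have /m_min/dvdpP[c qpE] : (map_poly (in_alg K) (q - p)).[w] = 0.
    by rewrite rmorphB hornerD hornerN pq subrr.
  apply/eqP; rewrite -subr_eq0 -hornerN -hornerD -rmorphB qpE rmorphM hornerM.
  by rewrite /= mz0 mulr0.
have f_add : zmod_morphism f.
  move=> x y; have [[p ->] [q ->]] := (genw x, genw y).
  by rewrite -hornerN -hornerD -rmorphB !fE rmorphB hornerD hornerN.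
have f_mul : monoid_morphism f.
  split; first by have := fE 1; rewrite !rmorph1 !hornerC.
  move=> x y; have [[p ->] [q ->]] := (genw x, genw y).
  by rewrite -hornerM -rmorphM !fE rmorphM hornerM.
pose fZ := GRing.isZmodMorphism.Build _ _ f f_add.
pose fM := GRing.isMonoidMorphism.Build _ _ f f_mul.
by constructor; exact: (HB.pack f fZ fM).
Qed.

(** An embedding [e] maps a generator [w] of [K] to a root of its minimal
    polynomial, and the roots are the images under [rho] of the Galois
    conjugates of [iota w]. *)
Lemma embedding_factor (K : fieldExtType rat) (L : splittingFieldType rat)
    (iota : 'AHom(K, L)) (F : numFieldType)
    (rho : {rmorphism L -> F}) (e : {rmorphism K -> F}) :
  galois 1 {:L} ->
  exists2 g, g \in 'Gal({:L} / 1)%g & forall x, e x = rho (g (iota x)).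
Proof.
move=> galL; have [w genw] := rat_ext_primitive K.
have [_ _ nL] := and3P galL.
have [r rG mE] := normalField_factors (sub1v _) nL _ (memvf (iota w)).
have [m mE'] : exists m, minPoly 1 (iota w) = map_poly (in_alg L) m.
  by have /polyOver1P := minPolyOver 1 (iota w).
have iotaE p : iota (map_poly (in_alg K) p).[w] = (map_poly (in_alg L) p).[iota w].
  rewrite -horner_map -map_poly_comp; congr (_ .[ _ ]); apply: eq_map_poly => a /=.
  by rewrite rmorph_alg.
have mw : (map_poly (in_alg K) m).[w] = 0.
  apply: (fmorph_inj iota); rewrite rmorph0; apply: (etrans (iotaE m)).
  by rewrite -mE'; apply/rootP/root_minPoly.
have : root (map_poly rho (minPoly 1 (iota w))) (e w).
  rewrite mE' -map_poly_comp.
  rewrite (@eq_map_poly _ _ _ ratr) => [|a]; last first.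
    exact: (fmorph_eq_rat (rho \o in_alg L)).
  by apply/rootP; rewrite -horner_rmorph_rat mw rmorph0.
pose factor (x : gal_of {:L}) := 'X - (rho (x (iota w)))%:P.
rewrite mE rmorph_prod (eq_bigr factor) => [|x _]; last first.
  by rewrite rmorphB /= map_polyX map_polyC.
rewrite -(big_map (fun x : gal_of {:L} => rho (x (iota w))) xpredT (fun a => 'X - a%:P)).
rewrite root_prod_XsubC => /mapP[g gr ewE].
have gG : g \in 'Gal({:L} / 1)%g by exact: (fintype.subsetP rG _ gr).
exists g => // x.
have [p ->] := genw x; rewrite iotaE horner_rmorph_rat ewE.
by rewrite -(horner_rmorph_rat _ _ (rho \o g)).
Qed.

(** * Algebraic integers *)

Lemma integral_int_rmorph {A B : nzRingType} (e : {rmorphism A -> B}) (x : A) :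
  integralOver (intr : int -> A) x -> integralOver (intr : int -> B) (e x).
Proof.
case=> p p_monic /rootP px0; exists p => //; apply/rootP.
rewrite (@eq_map_poly _ _ _ (e \o intr)) => [|a /=]; last by rewrite rmorph_int.
by rewrite map_poly_comp horner_map px0 rmorph0.
Qed.

Lemma integral_int_inj {A : nzRingType} {B : nzRingType} {e : {rmorphism A -> B}} {x : A} :
  injective e ->
  integralOver (intr : int -> B) (e x) -> integralOver (intr : int -> A) x.
Proof.
move=> inj_e [p p_monic /rootP px0]; exists p => //; apply/rootP.
apply: inj_e; rewrite rmorph0 -horner_map -map_poly_comp -[RHS]px0.
by congr (_ .[ _ ]); apply: eq_map_poly => a /=; rewrite rmorph_int.
Qed.

Lemma rat_integral_int (q : rat) :
  integralOver (intr : int -> rat) q -> q \is a Num.int.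
Proof.
move=> /(integral_int_rmorph (ratr : rat -> algC)) [p p_monic px0].
have q_int : ratr q \in Aint.
  apply: (root_monic_Aint px0); first exact: monic_map.
  by apply/polyOverP => i; rewrite coef_map /= intr_int.
have /intrP[m qm] := Cint_rat_Aint (Crat_rat q) q_int.
have -> : q = m%:~R
  by apply: (fmorph_inj (ratr : rat -> algC)); rewrite [LHS]qm rmorph_int.
exact: intr_int.
Qed.

(** A rational algebraic integer is an integer, and 1 and -1 are the only
    invertible integers. *)
Lemma rat_integral_unit (q : rat) : q != 0 ->
  integralOver (intr : int -> rat) q -> integralOver (intr : int -> rat) q^-1 ->
  q ^+ 2 = 1.
Proof.
move=> q0 /rat_integral_int/intrP[m qm] /rat_integral_int/intrP[n qn].
have : m * n = 1 by apply: (@intr_inj rat); rewrite intrM -qm -qn divff.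
move=> mn; have : m = 1 \/ m = -1.
  have /eqP : (`|m| * `|n|)%N = 1%N by rewrite -abszM mn.
  rewrite muln_eq1 => /andP[/eqP m1 _]; lia.
by case=> m1; rewrite qm m1.
Qed.

(** * Dihedral structure of groups of order 10 *)

Section Order10.

Local Open Scope group_scope.

(** A rotation [r] of order 5 generates a subgroup of index 2, which is normal,
    so r^h = r^k with k^2 = 1 modulo 5.  If k = 1, then [h] would commute with
    [r] and generate a normal subgroup. *)
Lemma order10_dihedral (gT : finGroupType) (G : {group gT}) (h : gT) :
  #|G| = 10%N -> h \in G -> #[h] = 2%N -> ~~ (<[h]> <| G) ->
  exists r, [/\ r \in G, #[r] = 5%N, r ^ h = r^-1
    & forall g, g \in G -> exists i j, g = h ^+ i * r ^+ j].
Proof.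
move=> cardG hG oh nnh.
have [r rG or] : {r | r \in G & #[r] = 5%N} by apply: Cauchy => //; rewrite cardG.
have cop : coprime #|<[h]>| #|<[r]>| by rewrite -!orderE oh or.
have hrG : <[h]> * <[r]> = G.
  apply/eqP; rewrite eqEcard mul_subG ?cycle_subG //=.
  by rewrite coprime_cardMg // -!orderE oh or cardG.
have genG g : g \in G -> exists i j, g = h ^+ i * r ^+ j.
  by rewrite -hrG => /mulsgP[_ _ /cycleP[i ->] /cycleP[j ->] ->]; exists i, j.
exists r; split => //.
have nrG : <[r]> <| G.
  apply: index2_normal; rewrite ?cycle_subG //.
  by rewrite -divgS ?cycle_subG // -orderE or cardG.
have hh : h * h = 1 by have := expg_order h; rewrite oh expgS expg1.
have r5 : r ^+ 5 = 1 by rewrite -or expg_order.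
have /cycleP[k rhk] : r ^ h \in <[r]>.
  by rewrite memJ_norm ?cycle_id // (fintype.subsetP (normal_norm nrG)).
have : r ^+ (k * k) = r.
  by rewrite expgM -rhk -conjXg -rhk -conjgM hh conjg1.
move/eqP; rewrite -{2}[r]expg1 eq_expg_mod_order or => kk.
have : (k %% 5 == 1 \/ k %% 5 == 4)%N.
  move: kk; rewrite -modnMm; have : (k %% 5 < 5)%N by rewrite ltn_mod.
  by move: (k %% 5)%N => [|[|[|[|[|]]]]] // *; [left|right].
rewrite rhk; case=> /eqP k5; last first.
  apply/eqP; rewrite eq_sym eq_invg_mul -expgS -[_ ^+ _]expg1.
  by rewrite -(expg_mod _ r5) -addn1 -modnDml k5.
case/negP: nnh; rewrite /normal cycle_subG hG /=.
have rh : commute r h.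
  by apply/commgP/conjg_fixP; rewrite rhk -(expg_mod _ r5) k5 expg1.
apply/fintype.subsetP => g /genG[i [j ->]].
rewrite groupM ?groupX //; first exact: (fintype.subsetP (normG _) _ (cycle_id h)).
apply: (fintype.subsetP (cent_sub _)); rewrite cent_cycle; apply/cent1P.
exact: commute_sym.
Qed.

End Order10.

(** * Embeddings and units of a D_5-extension *)

(** The real part of a real-valued embedding is a ring morphism. *)
Lemma real_embedding {R : realType} {K : fieldExtType rat} {e : {rmorphism K -> R[i]}} :
  is_real_valued e -> exists e' : {rmorphism K -> R}, forall x, (e' x)%:C = e x.
Proof.
move=> e_real; pose f x := complex.Re (e x).
have fE x : (f x)%:C = e x by rewrite /f; move: (e_real x); case: (e x) => a b /= ->.
have f_add : zmod_morphism f.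
  by move=> x y; rewrite /f raddfB /=; case: (e x) => a b; case: (e y) => c d.
have inj : injective (fun x : R => x%:C) by move=> x y [].
have f_mul : monoid_morphism f.
  split; first by apply: inj; rewrite fE rmorph1.
  by move=> x y; apply: inj; rewrite rmorphM /= !fE rmorphM.
pose fZ := GRing.isZmodMorphism.Build _ _ f f_add.
pose fM := GRing.isMonoidMorphism.Build _ _ f f_mul.
pose f' : {rmorphism K -> R} := HB.pack f fZ fM.
by exists f' => x; rewrite -fE.
Qed.

Lemma conjc_fixed {R : realType} {z : R[i]} : conjc z = z <-> complex.Im z = 0.
Proof. by case: z => a b; split=> [[] /= b0|/= ->]; [lra | rewrite oppr0]. Qed.

(** The embedding [rho] is normalised to extend the real embedding of [K]; complex
    conjugation composed with [rho] is again an embedding of [L], hence equals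
    [rho h] for some [h] in the Galois group, and [h] fixes [K].  It is not
    trivial, since otherwise all embeddings of [K] would be real, hence equal,
    and the Galois group would fix [K].  So [h] has order 2 and [K] is its fixed
    field; the subgroup it generates is not normal, because [L] is the smallest
    Galois extension containing [K]. *)
Lemma D5_frame {R : realType} {K : fieldExtType rat} :
  is_D5_extension K -> unique_real_embedding R K ->
  exists (L : splittingFieldType rat) (iota : 'AHom(K, L))
    (rho : {rmorphism L -> R[i]}) (h r : gal_of {:L}),
  [/\ galois 1 {:L},
      forall x, conjc (rho x) = rho (h x),
      forall y, h y = y <-> exists x, y = iota x,
      forall g, g \in 'Gal({:L} / 1)%g -> exists i j, g = (h ^+ i * r ^+ j)%g
    & [/\ #[r]%g = 5%N, (r ^ h)%g = r^-1%g & exists x, r (iota x) != iota x]].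
Proof.
move=> [dimK [L [iota [[galL closure] isoG]]]] [e0 e0_uniq].
have cardG : #|'Gal({:L} / 1)%g| = 10%N.
  by rewrite (card_isog isoG) (@card_dihedral 5).
have dimL : \dim {:L} = 10%N by have := galois_dim galL; rewrite dimv1 divn1 cardG.
have dim_iota : \dim (limg iota) = 5%N by rewrite limg_dim_eq ?dimK // (eqP (AHom_lker0 _)) capv0.
have [rho0] := rat_ext_embedding L R[i].
have [g0 g0G e0E] := embedding_factor K L iota _ rho0 (real_complex R \o e0) galL.
pose rho : {rmorphism L -> R[i]} := rho0 \o g0.
have rhoE x : rho (iota x) = (e0 x)%:C by rewrite /= -e0E.
have [h hG hE] := embedding_factor L L (id_ahom L) _ rho (conjc \o rho) galL.
have {}hE x : conjc (rho x) = rho (h x) by rewrite -[LHS]/((conjc \o rho) x) hE id_lfunE.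
have h_iota x : h (iota x) = iota x.
  by apply: (fmorph_inj rho); rewrite -hE rhoE conjc_real.
have hh : (h * h)%g = 1%g.
  apply/eqP/gal_eqP => x _; rewrite galM ?memvf // gal_id.
  by apply: (fmorph_inj rho); rewrite -!hE conjcK.
have moved : ~ forall g : gal_of {:L}, g \in 'Gal({:L} / 1)%g -> forall x, g (iota x) = iota x.
  move=> fix_iota.
  have fixed : (limg iota <= fixedField 'Gal({:L} / 1)%g)%VS.
    apply/subvP => _ /memv_imgP[x _ ->]; apply/fixedFieldP; first exact: memvf.
    by move=> g gG; apply: fix_iota.
  move/galois_fixedField: galL => fixE; move: fixed; rewrite fixE => /dimvS.
  by rewrite dim_iota dimv1.
have h1 : h != 1%g.
  apply/eqP => h1; apply: moved => g gG x.
  have real_g : is_real_valued (rho \o g \o iota).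
    by move=> y; apply/conjc_fixed; have := hE (g (iota y)); rewrite h1 gal_id.
  have [e' e'E] := real_embedding real_g.
  by apply: (fmorph_inj rho); rewrite rhoE -(e0_uniq e') e'E.
have oh : #[h]%g = 2%N.
  by apply: nt_prime_order => //; rewrite expgS expg1.
have imgE : limg iota = fixedField <[h]>%g.
  apply/eqP; rewrite eqEdim; apply/andP; split.
    apply/subvP => _ /memv_imgP[x _ ->]; apply/fixedFieldP; first exact: memvf.
    by move=> _ /cycleP[i ->]; elim: i => [|i IH]; rewrite ?gal_id // expgS galM ?memvf // h_iota.
  have := dim_fixedField <[h]>%G; rewrite -orderE oh dimL dim_iota => d2.
  have := field_dimS (fixedField_bound <[h]>%G); rewrite dimL.
  move: d2; set d := \dim _ => d2 dd.
  by have := divnK dd; rewrite -d2; lia.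
have h_img y : h y = y <-> exists x, y = iota x.
  split=> [hy|[x ->]]; last exact: h_iota.
  have : y \in limg iota.
    rewrite imgE; apply/fixedFieldP; first exact: memvf.
    by move=> _ /cycleP[i ->]; elim: i => [|i IH]; rewrite ?gal_id // expgS galM ?memvf // hy.
  by case/memv_imgP => x _ ->; exists x.
have nnh : ~~ (<[h]> <| 'Gal({:L} / 1))%g.
  apply/negP => /(normal_fixedField_galois galL) galh.
  have sub_fixed : (limg iota <= fixedField <[h]>%g)%VS by rewrite imgE.
  have /(congr1 (fun E : {subfield L} => \dim E)) := closure _ sub_fixed galh.
  by rewrite /= -imgE dim_iota dimL.
have [r [rG or rh genG]] := order10_dihedral _ _ _ cardG hG oh nnh.
exists L, iota, rho, h, r; split => //; split => //.
apply: boolp.contrapT => /boolp.forallNP fix_r; apply: moved => g /genG[i [j ->]] x.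
have iterE (s : gal_of {:L}) n : (forall x, s (iota x) = iota x) -> (s ^+ n)%g (iota x) = iota x.
  by move=> sE; elim: n => [|n IH]; rewrite ?gal_id // expgS galM ?memvf // sE.
rewrite galM ?memvf // iterE // iterE // => y.
by apply/eqP; apply: boolp.contrapT => /negP; exact: fix_r.
Qed.

(** [e0], [e1], [e2] represent the embeddings up to complex conjugation. *)
Definition D5_embeddings (R : realType) (K : fieldExtType rat)
    (e0 : {rmorphism K -> R}) (e1 e2 : {rmorphism K -> R[i]}) : Prop :=
  [/\ forall e : {rmorphism K -> R}, e =1 e0,
     ~ is_real_valued e1 /\ ~ is_real_valued e2,
     ~ (e2 =1 e1 \/ e2 =1 conjc \o e1)
   & forall e : {rmorphism K -> R[i]}, ~ is_real_valued e ->
       (e =1 e1 \/ e =1 conjc \o e1) \/ (e =1 e2 \/ e =1 conjc \o e2)].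

(** In logarithms: a0 + 2 a1 + 2 a2 = 0, and the unit group is stable under the
    operator (a0, a1, a2) -> (2 a1, a0 + a2, a1 + a2). *)
Definition unit_relations (R : realType) (K : fieldExtType rat)
    (e0 : {rmorphism K -> R}) (e1 e2 : {rmorphism K -> R[i]}) : Prop :=
  forall u, ring_of_integers_units u ->
    `|e0 u| * normc (e1 u) ^+ 2 * normc (e2 u) ^+ 2 = 1 /\
    exists u', [/\ ring_of_integers_units u', `|e0 u'| = normc (e1 u) ^+ 2,
      normc (e1 u') = `|e0 u| * normc (e2 u)
      & normc (e2 u') = normc (e1 u) * normc (e2 u)].

Lemma normc_ge0 {R : realType} (z : R[i]) : 0 <= normc z.
Proof. by case: z => a b; exact: sqrtr_ge0. Qed.

Lemma normc_conjc {R : realType} (z : R[i]) : normc (conjc z) = normc z.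
Proof. by case: z => a b /=; rewrite sqrrN. Qed.

Lemma normc_real {R : realType} (x : R) : normc x%:C = `|x|.
Proof. by rewrite /= expr0n addr0 sqrtr_sqr. Qed.

(** [e0], [e1], [e2] are the restrictions to [K] of rho, rho r, rho r^2.  As
    h r = r^-1 h, the element r(u) r^-1(u) is fixed by [h] and so lies in [K],
    and the product of the five conjugates r^k(u) is fixed by [r] and [h], so
    that it is a rational unit. *)
Lemma D5_units {R : realType} {K : fieldExtType rat} :
  is_D5_extension K -> unique_real_embedding R K ->
  exists e0 e1 e2, @D5_embeddings R K e0 e1 e2 /\ unit_relations R K e0 e1 e2.
Proof.
move=> hD5 hreal.
have [L [iota [rho [h [r [galL hE h_img genG [or rh [x0 rx0]]]]]]]] := D5_frame hD5 hreal.
have [e0 e0_uniq] := hreal.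
have h_iota x : h (iota x) = iota x by apply/h_img; exists x.
have r5 x : r (r (r (r (r x)))) = x.
  have : (r ^+ 5)%g x = x by rewrite -or expg_order gal_id.
  by rewrite 4!expgS expg1 !galM ?memvf.
(* From here on r^-1 is written r^4, and [h] is moved inwards by [hr]. *)
have rV x : (r^-1)%g x = r (r (r (r x))).
  by rewrite -[in LHS](r5 x) -galM ?memvf // mulgV gal_id.
have hr x : h (r x) = r (r (r (r (h x)))).
  by rewrite -galM ?memvf // conjgC rh galM ?memvf // rV.
pose e1 : {rmorphism K -> R[i]} := rho \o r \o iota.
pose e2 : {rmorphism K -> R[i]} := rho \o r \o r \o iota.
have rho0 x : rho (iota x) = (e0 x)%:C.
  have real0 : is_real_valued (rho \o iota).
    by move=> y; apply/conjc_fixed; rewrite /= hE h_iota.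
  by have [e eE] := real_embedding real0; rewrite -[LHS]eE e0_uniq.
have c1 x : conjc (e1 x) = rho (r (r (r (r (iota x))))) by rewrite /= hE hr h_iota.
have c2 x : conjc (e2 x) = rho (r (r (r (iota x)))).
  by rewrite /= hE !hr h_iota !r5.
have e1E x : e1 x = rho (r (iota x)) by [].
have e2E x : e2 x = rho (r (r (iota x))) by [].
have not_fixed : r (iota x0) <> iota x0 by apply/eqP.
have rho_inj := fmorph_inj rho.
have r_inj := fmorph_inj r.
exists e0, e1, e2; split.
  split=> //.
  - split=> real_e; apply: not_fixed.
    + have := conjc_fixed.2 (real_e x0); rewrite c1 e1E => /rho_inj/r_inj r3.
      have : iota x0 = r (r (r (r (r (r (iota x0)))))) by rewrite !r3.
      by rewrite r5.
    + by have := conjc_fixed.2 (real_e x0); rewrite c2 e2E => /rho_inj/r_inj/r_inj.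
  - case=> /(_ x0); first by rewrite [LHS]e2E => /rho_inj/r_inj.
    rewrite [RHS]c1 => /rho_inj/r_inj/r_inj r2; apply: not_fixed.
    by rewrite -[RHS]r5 -!r2.
  - move=> e e_nonreal; have [g gG eE] := embedding_factor K L iota _ rho e galL.
    have [i [j gE]] := genG g gG.
    have {}eE x : e x = rho ((r ^+ (j %% 5))%g (iota x)).
      rewrite eE gE galM ?memvf //; congr (rho _).
      rewrite -or expg_mod_order; congr ((r ^+ j)%g _).
      by elim: i {gE} => [|i IH]; rewrite ?gal_id // expgS galM ?memvf // h_iota.
    have : (j %% 5 < 5)%N by rewrite ltn_mod.
    move: (j %% 5)%N eE => [|[|[|[|[|//]]]]] eE _.
    + by case: e_nonreal => x; rewrite eE gal_id rho0.
    + by left; left => x; rewrite eE expg1 e1E.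
    + by right; left => x; rewrite eE expgS expg1 galM ?memvf.
    + by right; right => x; rewrite eE 2!expgS expg1 !galM ?memvf //= [RHS]c2.
    + by left; right => x; rewrite eE 3!expgS expg1 !galM ?memvf //= [RHS]c1.
have integral_r x : integralOver (intr : int -> L) x -> integralOver (intr : int -> L) (r x).
  exact: integral_int_rmorph.
have int_mul : forall x y : L, integralOver (intr : int -> L) x ->
    integralOver (intr : int -> L) y -> integralOver (intr : int -> L) (x * y).
  exact: integral_mul.
have norm1 x : normc (rho (r (iota x))) = normc (e1 x) by [].
have norm2 x : normc (rho (r (r (iota x)))) = normc (e2 x) by [].
have norm3 x : normc (rho (r (r (r (iota x))))) = normc (e2 x) by rewrite -c2 normc_conjc.
have norm4 x : normc (rho (r (r (r (r (iota x)))))) = normc (e1 x) by rewrite -c1 normc_conjc.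
have norm0 x : normc (rho (iota x)) = `|e0 x| by rewrite rho0 normc_real.
move=> u [u0 u_int uV_int].
have iota_int x : is_algebraic_integer x -> integralOver (intr : int -> L) (iota x).
  exact: integral_int_rmorph.
split.
  pose N x := iota x * r (iota x) * r (r (iota x)) * r (r (r (iota x))) * r (r (r (r (iota x)))).
  have N_int x : is_algebraic_integer x -> integralOver (intr : int -> L) (N x).
    move=> x_int; rewrite /N.
    by do ?[apply: (int_mul _ _) | apply: (integral_r _) | apply: (iota_int _)].
  have [q qE] : exists q, N u = in_alg L q.
    have : N u \in fixedField 'Gal({:L} / 1)%g.
      apply/fixedFieldP => [|g /genG[i [j ->]]]; first exact: memvf.
      have iterN (s : gal_of {:L}) n : s (N u) = N u -> (s ^+ n)%g (N u) = N u.
        by move=> sE; elim: n => [|n IH]; rewrite ?gal_id // expgS galM ?memvf // sE.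
      rewrite galM ?memvf // !iterN // /N !rmorphM /=; first by rewrite r5; ring.
      by rewrite !hr h_iota !r5; ring.
    have /galois_fixedField -> := galL.
    by case/vlineP => q ->; exists q.
  have q0 : q != 0.
    apply: contraNneq u0 => q0.
    by move/eqP: qE; rewrite q0 rmorph0 /N !mulf_eq0 !fmorph_eq0 !orbb.
  have NV : N u^-1 = in_alg L q^-1.
    by transitivity (N u)^-1; [rewrite /N !fmorphV !invfM | rewrite qE fmorphV].
  have q2 : q ^+ 2 = 1.
    apply: rat_integral_unit => //.
      by have := N_int _ u_int; rewrite qE; apply: integral_int_inj; apply: fmorph_inj.
    by have := N_int _ uV_int; rewrite NV; apply: integral_int_inj; apply: fmorph_inj.
  have : (normc (rho (N u))) ^+ 2 = 1.
    rewrite expr2 -ComplexField.Normc.normcM -rmorphM qE -rmorphM -expr2 q2 !rmorph1.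
    exact: ComplexField.Normc.normc1.
  rewrite /N !rmorphM /= !ComplexField.Normc.normcM norm0 norm1 norm2 norm3 norm4.
  move=> N2; apply/eqP; rewrite -(@pexpr_eq1 _ _ 2) //.
    by rewrite -N2; apply/eqP; ring.
  by rewrite !mulr_ge0 ?exprn_ge0 ?normc_ge0.
have [u' u'E] : exists u', r (iota u) * r (r (r (r (iota u)))) = iota u'.
  by apply/h_img; rewrite rmorphM /= !hr h_iota !r5 mulrC.
have iotaV x : iota x^-1 = (iota x)^-1 by exact: fmorphV.
have phi_int x y : r (iota x) * r (r (r (r (iota x)))) = iota y ->
    is_algebraic_integer x -> is_algebraic_integer y.
  move=> yE x_int; apply: integral_int_inj (fmorph_inj iota) _.
  have : integralOver (intr : int -> L) (iota y); last by [].
  by rewrite -yE; do ?[apply: (int_mul _ _) | apply: (integral_r _) | apply: (iota_int _)].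
exists u'; split.
- split.
  + have : iota u' != 0 by rewrite -u'E mulf_neq0 // !fmorph_eq0.
    by rewrite fmorph_eq0.
  + exact: phi_int u'E u_int.
  + by apply: (phi_int _ _ _ uV_int); rewrite !iotaV -u'E !fmorphV invfM.
- by rewrite -norm0 -u'E rmorphM ComplexField.Normc.normcM norm1 norm4 expr2.
- by rewrite -norm1 -u'E !rmorphM /= ComplexField.Normc.normcM r5 norm2 norm0 mulrC.
- by rewrite -norm2 -u'E !rmorphM /= ComplexField.Normc.normcM r5 norm3 norm1 mulrC.
Qed.

(** * The unit lattice in eigencoordinates *)

Lemma eigen_mx_inj (R : realType) (r1 s : nat) (i0 : 'I_r1) (j1 : 'I_s) (x y : 'rV[R]_2) :
  x *m eigen_mx R r1 s j1 = y *m eigen_mx R r1 s j1 -> x = y.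
Proof.
move=> xy; have := congr1 (fun A : 'rV_(r1 + s) => A 0 (lshift s i0)) xy.
have := congr1 (fun A : 'rV_(r1 + s) => A 0 (rshift r1 j1)) xy.
rewrite /= !mul_eigen_mxl !mul_eigen_mxr eqxx => ab sum.
have ab0 : alpha R - beta R != 0.
  have -> : alpha R - beta R = Num.sqrt 5 by rewrite /alpha /beta; field.
  by rewrite gt_eqF // sqrtr_gt0.
have p0 : x 0 0 = y 0 0.
  apply: (mulIf ab0).
  have -> : x 0 0 * (alpha R - beta R) =
    (x 0 0 * alpha R + x 0 1 * beta R) - beta R * (x 0 0 + x 0 1) by ring.
  by rewrite ab sum; ring.
have q0 : x 0 1 = y 0 1 by move: sum; rewrite p0 => /addrI.
apply/rowP => k; case: (unliftP 0 k) => [l ->|->] //.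
by rewrite (_ : lift 0 l = 1) //; apply: val_inj; case: l => [[]].
Qed.

(** The eigencoordinates (p, q) of (a0, 2 a1, 2 a2), found by solving
    p + q = a0 and alpha p + beta q = 2 a1; the denominator is alpha - beta. *)
Definition log_coords (R : realType) (a0 a1 : R) : 'rV[R]_2 :=
  \row_k ((if k == 0 then 2 * a1 - beta R * a0 else alpha R * a0 - 2 * a1) / Num.sqrt 5).

Lemma log_coordsK (R : realType) (a0 a1 : R) :
  let p := log_coords R a0 a1 0 0 in let q := log_coords R a0 a1 0 1 in
  [/\ p + q = a0, p * alpha R + q * beta R = 2 * a1
    & p * beta R + q * alpha R = - a0 - 2 * a1].
Proof.
have s0 : (Num.sqrt 5 : R) != 0 by rewrite gt_eqF // sqrtr_gt0.
rewrite !mxE /= /alpha /beta; split.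
- by field.
- by field.
- apply: (mulIf s0); set s := Num.sqrt 5 in s0 *.
  have -> : ((2 * a1 - (- s - 1) / 2 * a0) / s * ((- s - 1) / 2)
      + ((s - 1) / 2 * a0 - 2 * a1) / s * ((s - 1) / 2)) * s = - s * a0 - 2 * a1 * s by field.
  ring.
Qed.

(** The operator of [unit_relations] has eigenvalues alpha and beta in the
    eigencoordinates. *)
Lemma log_coords_mul (R : realType) (a0 a1 a2 : R) :
  a0 + 2 * a1 + 2 * a2 = 0 ->
  let p := log_coords R a0 a1 0 0 in let q := log_coords R a0 a1 0 1 in
  log_coords R (2 * a1) (a0 + a2) 0 0 = alpha R * p /\
  log_coords R (2 * a1) (a0 + a2) 0 1 = beta R * q.
Proof.
move=> sum0; have a2E : 2 * a2 = - a0 - 2 * a1 by lra.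
rewrite !mxE /= !(mulrA _ _ (Num.sqrt 5)^-1); split; congr (_ / _).
- have -> : alpha R * (2 * a1 - beta R * a0) = 2 * alpha R * a1 - (alpha R * beta R) * a0 by ring.
  rewrite alphaM; have -> : beta R = - 1 - alpha R by rewrite -(alphaD R); ring.
  transitivity (2 * a0 + 2 * a2 - (- 1 - alpha R) * (2 * a1)); first by ring.
  by rewrite a2E; ring.
- have -> : beta R * (alpha R * a0 - 2 * a1) = (alpha R * beta R) * a0 - 2 * beta R * a1 by ring.
  rewrite alphaM; have -> : beta R = - 1 - alpha R by rewrite -(alphaD R); ring.
  transitivity (alpha R * (2 * a1) - (2 * a0 + 2 * a2)); first by ring.
  by rewrite a2E; ring.
Qed.

Theorem theorem1p1 (R : realType) (K : fieldExtType rat) (r1 s : nat)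
    (sigma : 'I_r1 -> {rmorphism K -> R})
    (tau : 'I_s -> {rmorphism K -> R[i]})
    (hemb : enumerates_embeddings sigma tau)
    (hD5 : is_D5_extension K)
    (hreal : unique_real_embedding R K)
    (B : 'M[R]_(2, r1 + s))
    (hB : is_lattice_basis (unit_lattice sigma tau) B) :
  (@GL2Z_orbit R @` @circle_arc R) (shape_class B).
Proof.
have [e0 [e1 [e2 [[e0_uniq [e1_cplx e2_cplx] e12 e_all] relations]]]] := D5_units hD5 hreal.
have [sigma_all tau_cplx tau_all] := hemb.
have [i0 [_ i0P]] := sigma_all e0.
(* There are one real place and two complex ones: [i0], [j1], [j2]. *)
have i0_uniq i : i = i0 by rewrite (i0P i (e0_uniq _)).
have [j1 [tau1 j1P]] := tau_all e1 e1_cplx.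
have [j2 [tau2 j2P]] := tau_all e2 e2_cplx.
have j12 j : j = j1 \/ j = j2.
  case: (e_all (tau j) (tau_cplx j)) => [] [] tauE; [left|left|right|right].
  - by rewrite (j1P j) //; left.
  - by rewrite (j1P j) //; right => x; rewrite tauE /= conjcK.
  - by rewrite (j2P j) //; left.
  - by rewrite (j2P j) //; right => x; rewrite tauE /= conjcK.
have j21 : j2 != j1.
  apply/eqP => j2E; rewrite j2E in tau2; apply: e12.
  case: tau1 => t1; case: tau2 => t2.
  - by left => x; rewrite -t1 -t2.
  - by right => x; rewrite /= -t1 -t2.
  - by right => x; rewrite /= -t2 -t1 conjcK.
  - by left => x; rewrite -t2 -t1.
have norm1 u : normc (tau j1 u) = normc (e1 u).
  by case: tau1 => <-; rewrite ?normc_conjc.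
have norm2 u : normc (tau j2 u) = normc (e2 u).
  by case: tau2 => <-; rewrite ?normc_conjc.
pose a0 u := ln `|e0 u|; pose a1 u := ln (normc (e1 u)); pose a2 u := ln (normc (e2 u)).
have normc_gt0 (e : {rmorphism K -> R[i]}) u : u != 0 -> 0 < normc (e u).
  move=> u0; rewrite lt_def normc_ge0 andbT; apply: contraNneq u0.
  by move/ComplexField.Normc.eq0_normc/eqP; rewrite fmorph_eq0.
have norm_gt0 u : u != 0 -> 0 < `|e0 u| by rewrite normr_gt0 fmorph_eq0.
have sum0 u : ring_of_integers_units u -> a0 u + 2 * a1 u + 2 * a2 u = 0.
  move=> uU; have [prod1 _] := relations u uU; have [u0 _ _] := uU.
  have [[n0 n1] n2] := (norm_gt0 u u0, normc_gt0 e1 u u0, normc_gt0 e2 u u0).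
  have : ln (`|e0 u| * normc (e1 u) ^+ 2 * normc (e2 u) ^+ 2) = 0 by rewrite prod1 ln1.
  rewrite lnM ?posrE ?mulr_gt0 ?exprn_gt0 // lnM ?posrE ?exprn_gt0 //.
  by rewrite !lnXn // !mulr_natl.
pose crd u := log_coords R (a0 u) (a1 u).
have LogE u : ring_of_integers_units u -> Log sigma tau u = crd u *m eigen_mx R r1 s j1.
  move=> uU; have [ca cb cc] := log_coordsK R (a0 u) (a1 u).
  apply/rowP => k; rewrite -[k]splitK; case: (split k) => l /=.
    by rewrite mul_eigen_mxl /crd ca /Log row_mxEl mxE (e0_uniq (sigma l)).
  rewrite mul_eigen_mxr /crd cb cc /Log row_mxEr mxE.
  case: (j12 l) => ->; first by rewrite eqxx norm1.
  rewrite (negPf j21) norm2 -[LHS]subr0 -(sum0 u uU) -/(a2 u).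
  by ring.
have [B_free B_span] := hB.
have rowB i : exists u, ring_of_integers_units u /\ row i B = Log sigma tau u.
  have : unit_lattice sigma tau (row i B).
    rewrite B_span; exists (delta_mx 0 i) => //.
    by rewrite map_delta_mx rowE.
  by case=> u uU <-; exists u.
have [u uP] := boolp.choice rowB.
pose C : 'M[R]_2 := \matrix_i crd (u i).
have BE : B = C *m eigen_mx R r1 s j1.
  by apply/row_matrixP => i; rewrite row_mul rowK (uP i).2 LogE //; apply: (uP i).1.
have CE i k : C i k = crd (u i) 0 k by rewrite mxE.
(* Stability of the unit lattice makes the operator an integral matrix. *)
have C_mul i : exists z : 'rV[int]_2,
    alpha R * C i 0 = (z 0 0)%:~R * C 0 0 + (z 0 1)%:~R * C 1 0 /\
    beta R * C i 1 = (z 0 0)%:~R * C 0 1 + (z 0 1)%:~R * C 1 1.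
  have uU := (uP i).1; have [_ [u' [u'U n0 n1 n2]]] := relations _ uU.
  have [u0 _ _] := uU.
  have [z _ zE] : [set map_mx (intr : int -> R) z *m B | z in [set: 'rV[int]_2]] (Log sigma tau u').
    by rewrite -B_span; exists u'.
  exists z.
  have crdE : crd u' = map_mx intr z *m C.
    by apply: (eigen_mx_inj R r1 s i0 j1); rewrite -LogE // -mulmxA -BE zE.
  have zC k : (map_mx intr z *m C) 0 k = (z 0 0)%:~R * C 0 k + (z 0 1)%:~R * C 1 k.
    by rewrite mxE sum_ord2 ![map_mx _ _ _ _]mxE.
  have [pE qE] := log_coords_mul R _ _ _ (sum0 _ uU).
  have crd' : crd u' = log_coords R (2 * a1 (u i)) (a0 (u i) + a2 (u i)).
    rewrite /crd /a0 /a1 n0 n1 lnXn ?normc_gt0 // mulr_natl lnM ?posrE ?norm_gt0 ?normc_gt0 //.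
  by rewrite -!zC -crdE crd' pE qE !CE.
have [M MP] := boolp.choice C_mul.
have ME i k : (\matrix_i M i) i k = M i 0 k by rewrite mxE.
rewrite BE; apply: (eigen_shape R r1 s i0 j1 j2 C (\matrix_i M i)) => //.
- (* [B] factors through [C], so [C] has rank 2. *)
  suff : C \in unitmx by rewrite unitmxE unitfE.
  rewrite -row_free_unit /row_free eqn_leq rank_leq_row /=.
  by rewrite -{1}(eqP B_free) BE mxrankM_maxl.
- by move=> i; rewrite !ME (MP i).1.
- by move=> i; rewrite !ME (MP i).2.
Qed.
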